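(* Let $q>9$ be a prime power with $q\equiv 1 \pmod 4$. Every signed graph $G$ with maximum average degree $\mathrm{mad}(G) < 4-\frac{8}{q+3}$ admits a homomorphism to the signed graph $SP_q^+$. That is, $\chi_s(\mathcal{M}_{4-\frac{8}{q+3}}) \le q+1$.
   Context: A signed graph $G=(V,E,s)$ is a finite simple graph $(V,E)$ (no loops, no parallel edges) together with a signature $s:E\to\{-1,+1\}$; edges with sign $+1$ are positive, with sign $-1$ negative. Switching a vertex $v$ reverses the sign of every edge incident to $v$; two signed graphs are switching equivalent if one can be obtained from the other by a sequence of switches. For signed graphs $G$ and $H$, a map $\varphi:V(G)\to V(H)$ is a homomorphism if there is a signed graph $G'$ switching equivalent to $G$ such that for every edge $uv$ of $G'$, $\varphi(u)\varphi(v)$ is an edge of $H$ with the same sign as $uv$ in $G'$. The chromatic number $\chi_s(G)$ is the minimum order of a signed graph $H$ such that $G$ admits a homomorphism to $H$; for a class $\mathcal{C}$ of signed graphs, $\chi_s(\mathcal{C})$ is the maximum of $\chi_s(G)$ over $G\in\mathcal{C}$. The maximum average degree $\mathrm{mad}(G)$ is the maximum of $2|E(H)|/|V(H)|$ over all (nonempty) subgraphs $H$ of the underlying graph; $\mathcal{M}_k$ denotes the class of signed graphs with $\mathrm{mad} < k$. For a prime power $q\equiv 1 \pmod 4$, the signed Paley graph $SP_q$ has vertex set the finite field $\mathbb{F}_q$, and any two distinct vertices $u,v$ are joined by a positive edge if $u-v$ is a square in $\mathbb{F}_q$ and by a negative edge otherwise. For a signed graph $H$, $H^+$ denotes the signed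 graph obtained from $H$ by adding one new vertex joined by a positive edge to every vertex of $H$. Thus $SP_q^+$ is a complete signed graph on $q+1$ vertices. *)

(* Defs.v *)
From mathcomp Require Import all_boot all_order all_algebra all_field.
Set Implicit Arguments. Unset Strict Implicit. Unset Printing Implicit Defensive.
Import Order.TTheory GRing.Theory Num.Theory.

(* A signed graph on a finite vertex type V is given by
   - adj : rel V, a symmetric irreflexive adjacency relation (simple graph),
   - sg  : V -> V -> bool, the signature (true = positive edge, false = negative),
     required symmetric; only its values on edges matter. *)

Definition signed_graph (V : finType) (adj : rel V) (sg : V -> V -> bool) :=
  [/\ symmetric adj, irreflexive adj & forall u v, sg u v = sg v u].

Definition switch_at (V : finType) (w : V) (sg : V -> V -> bool) : V -> V -> bool :=
  fun x y => if (x == w) (+) (y == w) then ~~ sg x y else sg x y.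

Definition switch_seq (V : finType) (ws : seq V) (sg : V -> V -> bool) :=
  foldr (@switch_at V) sg ws.

Definition switching_equiv (V : finType) (adj : rel V) (sg sg' : V -> V -> bool) :=
  exists ws : seq V, forall u v, adj u v -> sg' u v = switch_seq ws sg u v.

Definition signed_hom (V W : finType) (adj : rel V) (sg : V -> V -> bool)
  (adjH : rel W) (sgH : W -> W -> bool) (phi : V -> W) :=
  exists sg' : V -> V -> bool, switching_equiv adj sg sg' /\
    forall u v, adj u v -> adjH (phi u) (phi v) && (sgH (phi u) (phi v) == sg' u v).

(* Maximum average degree: max over nonempty vertex sets S of
   2|E(G[S])| / |S|; 2|E(G[S])| = number of ordered adjacent pairs in S. *)
Definition mad (V : finType) (adj : rel V) : rat :=
  \big[Num.max/0%R]_(S : {set V} | S != set0)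
     ((#|[set p in setX S S | adj p.1 p.2]|)%:R / (#|S|)%:R)%R.

(* Signed Paley graph SP_q^+ over a finite field F, vertex set option F,
   where None is the added apex vertex. *)
Definition is_square (F : finFieldType) (x : F) : bool := [exists w : F, (w * w == x)%R].

Definition SPplus_adj (F : finFieldType) : rel (option F) :=
  fun a b => a != b.

Definition SPplus_sign (F : finFieldType) (a b : option F) : bool :=
  match a, b with
  | Some u, Some v => is_square (u - v)%R
  | _, _ => true
  end.

(* Main.v *)
(* Up to switching, a homomorphism to SP_q^+ is a colouring by pairs (vertex of SP_q^+,
   switching bit), and a coloured neighbour u of v forces one key on the colour of v.
   Write q = 4m + 1. The sign matrix of SP_q^+ is a conference matrix, so j <= 3
   compatible keys leave at least c_j colours, with
   c_0 = 8m + 4, c_1 = 4m + 1, c_2 = 2m, c_3 = m - 1.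
   In a minimal counterexample, call vertices of degree at most 3 small. Deleting the
   edges from a to a set S of small neighbours (rather than deleting a or S) leaves a graph
   whose colouring still witnesses that the keys around a, and around each w in S, are
   compatible. Then a can be recoloured with one of c_j colours, where j is its number of
   remaining neighbours, as soon as they outnumber the sum over S of deg w - 1, since each
   remaining neighbour of some w in S forbids one colour; finally S is recoloured.
   Hence the degrees are not 1, small vertices are not adjacent, and a vertex with j <= 3
   big neighbours has many small ones; discharging to the small vertices concludes. *)
Require Import Defs.
From mathcomp Require Import all_boot all_order all_algebra all_solvable all_field.
From mathcomp Require Import zify ring.
Import Order.TTheory GRing.Theory Num.Theory.
Set Implicit Arguments. Unset Strict Implicit. Unset Printing Implicit Defensive.

(** * The quadratic character and the conference matrix of SP_q^+ *)

Section QuadraticCharacter.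
Variable F : finFieldType.
Hypothesis hF : #|F| %% 4 = 1.
Local Open Scope ring_scope.

Lemma exists_prim_root : exists g : F, #|F|.-1.-primitive_root g.
Proof.
have q1 : (1 < #|F|)%N by apply: finNzRing_gt1.
pose rs := [seq x <- enum F | x != 0].
have szrs : size rs = #|F|.-1.
  rewrite size_filter -(cardC1 (0 : F)) cardE size_filter.
  by rewrite -enumT; apply: eq_count => x; rewrite !inE.
have /hasP[g _ pg] : has #|F|.-1.-primitive_root rs.
  apply: has_prim_root; rewrite ?szrs ?filter_uniq ?enum_uniq //.
    by rewrite -subn1 subn_gt0.
  apply/allP=> x; rewrite mem_filter => /andP[x0 _].
  apply/unity_rootP; apply: (mulfI x0).
  by rewrite -exprS prednK ?expf_card ?mulr1 // ltnW.
  by rewrite -enumT enum_uniq.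
by exists g.
Qed.

Lemma prim_root_expP (g x : F) :
  #|F|.-1.-primitive_root g -> x != 0 -> exists i, x = g ^+ i.
Proof.
move=> pg x0; have q1 : (1 < #|F|)%N by apply: finNzRing_gt1.
have /(prim_rootP pg)[i ->] : x ^+ #|F|.-1 = 1; last by exists i.
by apply: (mulfI x0); rewrite -exprS prednK ?expf_card ?mulr1 // ltnW.
Qed.

Lemma prim_root_neq0 (g : F) n : n.-primitive_root g -> g != 0.
Proof.
move=> pg; apply: contra_eq_neq (prim_expr_order pg) => ->.
by rewrite expr0n gtn_eqF ?(prim_order_gt0 pg) // eq_sym oner_eq0.
Qed.

(** Since [#|F|.-1] is even, a power of [g] determines the parity of its exponent. *)
Lemma is_square_prim_root (g : F) i :
  #|F|.-1.-primitive_root g -> is_square (g ^+ i) = ~~ odd i.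
Proof.
move=> pg; have q1 : (1 < #|F|)%N by apply: finNzRing_gt1.
apply/existsP/idP => [[w /eqP ww]|ev]; last first.
  exists (g ^+ i./2); apply/eqP; rewrite -exprD addnn.
  by congr (_ ^+ _); lia.
have w0 : w != 0.
  by apply: contra_eq_neq ww => ->; rewrite mul0r eq_sym expf_neq0 ?(prim_root_neq0 pg).
have [j wj] := prim_root_expP pg w0.
move/eqP: ww; rewrite wj -exprD (eq_prim_root_expr pg) => /eqP e.
have : ((j + j) %% #|F|.-1 %% 2 = i %% #|F|.-1 %% 2)%N by rewrite e.
rewrite !modn_dvdm; lia.
Qed.

Lemma is_squareM (x y : F) :
  x != 0 -> y != 0 -> is_square (x * y) = (is_square x == is_square y).
Proof.
have [g pg] := exists_prim_root => x0 y0.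
have [i ->] := prim_root_expP pg x0; have [j ->] := prim_root_expP pg y0.
rewrite -exprD !is_square_prim_root // oddD.
by case: (odd i); case: (odd j).
Qed.

Lemma is_square_sqr (x : F) : is_square (x * x).
Proof. by apply/existsP; exists x. Qed.

(** [-1] is the middle power of a primitive root, and its exponent [(#|F|.-1)./2] is even because
    [#|F| %% 4 = 1]. *)
Lemma is_squareN1 : is_square (-1 : F).
Proof.
have [g pg] := exists_prim_root.
have q1 : (1 < #|F|)%N by apply: finNzRing_gt1.
have e : g ^+ (#|F|.-1)./2 = -1.
  have : (g ^+ (#|F|.-1)./2) ^+ 2 = 1.
    rewrite -exprM -(prim_expr_order pg); congr (_ ^+ _); lia.
  move/eqP; rewrite sqrf_eq1 => /orP[|/eqP //].
  rewrite -(expr0 g) (eq_prim_root_expr pg) mod0n modn_small; lia.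
rewrite -e is_square_prim_root //; lia.
Qed.

Lemma is_squareN (x : F) : is_square (- x) = is_square x.
Proof.
have [->|x0] := eqVneq x 0; first by rewrite oppr0.
by rewrite -mulN1r is_squareM ?oppr_eq0 ?oner_eq0 // is_squareN1.
Qed.

Lemma exists_nonsquare : exists2 a : F, a != 0 & ~~ is_square a.
Proof.
have [g pg] := exists_prim_root.
have q1 : (1 < #|F|)%N by apply: finNzRing_gt1.
exists g; first exact: prim_root_neq0 pg.
by rewrite -(expr1 g) is_square_prim_root.
Qed.

Definition chi (x : F) : int := if x == 0 then 0 else (-1) ^+ ~~ is_square x.

Lemma chiM (x y : F) : chi (x * y) = chi x * chi y.
Proof.
rewrite /chi mulf_eq0.
have [->|x0] /= := eqVneq x 0; first by rewrite mul0r.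
have [_|y0] := eqVneq y 0; first by rewrite mulr0.
by rewrite is_squareM //; case: (is_square x); case: (is_square y).
Qed.

(** Multiplication by a nonsquare permutes the field and negates [chi]. *)
Lemma sum_chi : \sum_x chi x = 0.
Proof.
have [a a0 nsa] := exists_nonsquare.
have ca : chi a = -1 by rewrite /chi (negbTE a0) nsa.
have e x : - chi x = chi (a * x) by rewrite chiM ca mulN1r.
have : \sum_x chi x = - \sum_x chi x; last by lia.
by rewrite -sumrN (eq_bigr _ (fun x _ => e x)) [LHS](reindex_inj (mulfI a0)).
Qed.

Lemma sum_chi_affine (b c : F) : b != 0 ->
  \sum_x chi (b * x + c) = 0.
Proof.
move=> b0; rewrite -[RHS]sum_chi [RHS](reindex (fun x => b * x + c)) //.
exists (fun x => b^-1 * (x - c)) => x _; first by rewrite addrK mulKf.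
by rewrite mulVKf // subrK.
Qed.

(* For x != 0, chi x * chi (x + c) = chi (1 + c / x); the junk value 0^-1 = 0
   makes x |-> 1 + c / x a bijection of F. *)
Lemma sum_chi_shift (c : F) : c != 0 -> \sum_x chi x * chi (x + c) = -1.
Proof.
move=> c0; have chi0 : chi 0 = 0 by rewrite /chi eqxx.
have chi1 : chi 1 = 1.
  by rewrite /chi oner_eq0; have := is_square_sqr 1; rewrite mulr1 => ->.
have e x : chi x * chi (x + c) = chi (c * x^-1 + 1) - (x == 0)%:R.
  have [->|x0] := eqVneq x 0; first by rewrite chi0 mul0r invr0 mulr0 !add0r chi1 subrr.
  rewrite subr0 -chiM (_ : x * (x + c) = x * x * (c * x^-1 + 1)); last by field.
  by rewrite chiM [chi (x * x)]/chi mulf_eq0 (negbTE x0) is_square_sqr mul1r.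
under eq_bigr do rewrite e.
rewrite sumrB (reindex_inj (h := GRing.inv)) /=; last exact: invr_inj.
under eq_bigr do rewrite invrK.
rewrite sum_chi_affine // sub0r (bigD1 0) //= eqxx big1 ?addr0 // => x.
by move/negbTE->.
Qed.

Definition conf (a b : option F) : int :=
  if a == b then 0 else (-1) ^+ ~~ SPplus_sign a b.

Lemma sum_option (f : option F -> int) : \sum_a f a = f None + \sum_x f (Some x).
Proof.
rewrite (bigD1 None) //=; congr (_ + _).
rewrite (reindex_omap Some id) /=; last by case.
by apply: eq_bigl => x; rewrite eqxx.
Qed.

Lemma SPplus_signC (a b : option F) : SPplus_sign a b = SPplus_sign b a.
Proof. by case: a b => [x|] [y|] //=; rewrite -opprB is_squareN. Qed.

Lemma conf_Some x y : conf (Some x) (Some y) = chi (x - y).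
Proof. by rewrite /conf /chi subr_eq0 (inj_eq Some_inj). Qed.

(** The apex column is constant on the field, which leaves a sum of [chi]. For two field columns,
    the apex row contributes 1 and cancels the -1 of [sum_chi_shift]. *)
Lemma sum_conf b c : b != c -> \sum_a conf a b * conf a c = 0.
Proof.
have half y : \sum_a conf a None * conf a (Some y) = 0.
  rewrite sum_option mul0r add0r.
  under eq_bigr do rewrite conf_Some mul1r -[_ - _]/(_ + _) -[X in X + _]mul1r.
  by rewrite sum_chi_affine ?oner_eq0.
case: b c => [y|] [z|] // yz; last by under eq_bigr do rewrite mulrC; exact: half.
  rewrite sum_option (_ : conf _ _ * _ = 1) //.
  under eq_bigr do rewrite !conf_Some.
  rewrite (reindex_inj (h := fun x => x + y)) /=; last exact: addIr.
  under eq_bigr do rewrite addrK -addrA.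
  by rewrite sum_chi_shift // subr_eq0 -(inj_eq Some_inj).
Qed.
End QuadraticCharacter.

(** * Counting vertices with prescribed relative signs *)

Lemma sum_indicator (T : finType) (P : pred T) :
  (\sum_a (P a)%:R = #|[set a | P a]|%:R :> int)%R.
Proof.
rewrite -sum1_card natr_sum big_mkcond [RHS]big_mkcond.
by apply: eq_bigr => a _; rewrite inE; case: (P a).
Qed.

Section Counting.
Variables (F : finFieldType) (m : nat).
Hypothesis cardF : #|F| = 4 * m + 1.

Let hF : #|F| %% 4 = 1.
Proof. by rewrite cardF; lia. Qed.

Let sum1_option : (\sum_(a : option F) 1 = (4 * m + 2)%:R :> int)%R.
Proof. by rewrite big_const iter_addr_0 card_option cardF; congr (_%:R)%R; lia. Qed.

Let card_eq (e : option F) : #|[set a | a == e]| = 1.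
Proof. by rewrite cardsE card1. Qed.

(** Outside [b] and [c] the left side of [le] is twice the indicator of [P]; at [b] and [c] it is 1.
    Summed over [a], orthogonality gives 4m + 2 <= 2n + 2. *)
Lemma pair_count (b c : option F) (beta : bool) : b != c ->
  2 * m <= #|[set a | [&& a != b, a != c &
     SPplus_sign a b (+) SPplus_sign a c == beta]]|.
Proof.
move=> bc; set P := fun a => _.
have le a : (1 + (-1) ^+ beta * (conf a b * conf a c) <=
             2 * (P a)%:R + (a == b)%:R + (a == c)%:R :> int)%R.
  rewrite /P /conf {P}; case: eqP => [->|_] /=; first by rewrite (negbTE bc); lia.
  case: eqP => _ /=; first by lia.
  by case: (SPplus_sign a b); case: (SPplus_sign a c); case: beta.
have := ler_sum (index_enum _) (fun a (_ : predT a) => le a).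
rewrite !big_split /= -!mulr_sumr /= (sum_conf hF bc) mulr0 addr0 !sum_indicator.
rewrite sum1_option.
rewrite !card_eq; set n := #|_|; lia.
Qed.

Lemma triple_count (b c d : option F) (beta gamma : bool) :
  b != c -> b != d -> c != d ->
  m.-1 <= #|[set a | [&& a != b, a != c, a != d,
     SPplus_sign a b (+) SPplus_sign a c == beta &
     SPplus_sign a b (+) SPplus_sign a d == gamma]]|.
Proof.
move=> bc bd cd; set P := fun a => _.
(* Away from [b], [c], [d] the left side is the product of the two factors for [beta] and [gamma],
   expanded with [conf a b] squaring to 1. At these three vertices it is at most 2, so 4m + 2 <= 4n
   + 6. *)
have le a : (1 + (-1) ^+ beta * (conf a b * conf a c)
               + (-1) ^+ gamma * (conf a b * conf a d)
               + (-1) ^+ (beta (+) gamma) * (conf a c * conf a d) <=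
             4 * (P a)%:R + 2 * (a == b)%:R + 2 * (a == c)%:R
               + 2 * (a == d)%:R :> int)%R.
  rewrite /P /conf {P}; case: eqP => [->|_] /=.
    rewrite (negbTE bc) (negbTE bd).
    by case: (SPplus_sign b c); case: (SPplus_sign b d); case: beta; case: gamma.
  case: eqP => [->|_] /=.
    rewrite (negbTE cd).
    by case: (SPplus_sign c b); case: (SPplus_sign c d); case: beta; case: gamma.
  case: eqP => [->|_] /=.
    by case: (SPplus_sign d b); case: (SPplus_sign d c); case: beta; case: gamma.
  by case: (SPplus_sign a b); case: (SPplus_sign a c); case: (SPplus_sign a d);
    case: beta; case: gamma.
have := ler_sum (index_enum _) (fun a (_ : predT a) => le a).
rewrite !big_split /= -!mulr_sumr /= !(sum_conf hF) // !mulr0 !addr0 !sum_indicator.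
rewrite sum1_option.
rewrite !card_eq; set n := #|_|; lia.
Qed.
End Counting.

(** * Colours and recolouring *)

(* A colour is a vertex of SP_q^+ with a switching bit; the key k requires of the colour x
   that x.1 and k.1 be joined by an edge of sign x.2 (+) k.2. *)
Definition key_ok (F : finFieldType) (k x : option F * bool) :=
  (x.1 != k.1) && (SPplus_sign x.1 k.1 == x.2 (+) k.2).

(* Number of colours that j compatible keys leave over a field of order 4m + 1. *)
Definition capacity (m j : nat) :=
  match j with 0 => 8 * m + 4 | 1 => 4 * m + 1 | 2 => 2 * m | _ => m.-1 end.

Section Colours.
Variables (F : finFieldType) (m : nat).
Hypothesis cardF : #|F| = 4 * m + 1.
Local Notation colour := (option F * bool)%type.

(** The colour [x] and the vertex of a key it satisfies force the bit of that key. Hence an existing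
    colour certifies that the keys around it are compatible. *)
Lemma key_ok_inj (k l x : colour) :
  key_ok k x -> key_ok l x -> k.1 = l.1 -> k = l.
Proof.
case: k l x => [k b] [l c] [x d] /andP[_ /eqP /= ek] /andP[_ /eqP /= el] /= kl.
by subst l; congr pair; move: ek; rewrite el; case: d {el}; case: b; case: c.
Qed.

(** The first key determines the switching bit from the vertex, so only vertices remain to be
    counted; each further key prescribes a sign relative to the first. *)
Lemma capacity_uniq (s : seq colour) : uniq [seq k.1 | k <- s] -> size s <= 3 ->
  capacity m (size s) <= #|[set x : colour | all ((@key_ok F)^~ x) s]|.
Proof.
have lift (P : pred (option F)) (k : colour) :
    (forall y, P y -> all ((@key_ok F)^~ (y, SPplus_sign y k.1 (+) k.2)) s) ->
    #|[set y | P y]| <= #|[set x : colour | all ((@key_ok F)^~ x) s]|.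
  move=> Ps; rewrite -(card_imset (f := fun y => (y, SPplus_sign y k.1 (+) k.2)));
    last by move=> y z [].
  by apply/subset_leq_card/subsetP => _ /imsetP[y + ->]; rewrite !inE; exact: Ps.
case: s lift => [|k [|l [|n [|//]]]] lift.
- move=> _ _ /=; rewrite (_ : [set _ | _] = setT); last by apply/setP=> x; rewrite !inE.
  by rewrite cardsT card_prod card_option card_bool cardF; lia.
- move=> _ _ /=.
  apply: leq_trans (lift (fun y => y != k.1) k _) => [|y yk].
    have := cardsC1 k.1; rewrite card_option cardF.
    by rewrite (_ : [set~ k.1] = [set y | y != k.1]) => [->|]; [lia|apply/setP=> x; rewrite !inE].
  by rewrite /= /key_ok yk /= addbK eqxx.
- rewrite /= inE andbT => kl _.
  apply: leq_trans (pair_count cardF (k.2 (+) l.2) kl) (lift _ k _) => y.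
  case/and3P=> yk yl /eqP e; rewrite /= /key_ok yk yl /=; move: e.
  by do 2!case: SPplus_sign; case: k.2; case: l.2.
- rewrite /= !inE !negb_or andbT => /andP[/andP[kl kn] ln] _.
  apply: leq_trans (triple_count cardF (k.2 (+) l.2) (k.2 (+) n.2) kl kn ln) (lift _ k _) => y.
  case/and5P=> yk yl yn /eqP e /eqP e'; rewrite /= /key_ok yk yl yn /=.
  move: e e'.
  by do 3!case: SPplus_sign; case: k.2; case: l.2; case: n.2.
Qed.

Lemma capacity_compat (s : seq colour) j :
  {in s &, forall k l, k.1 = l.1 -> k = l} -> size s <= j -> j <= 3 ->
  capacity m j <= #|[set x : colour | all ((@key_ok F)^~ x) s]|.
Proof.
move=> inj sj j3; rewrite (_ : [set _ | _] = [set x : colour | all ((@key_ok F)^~ x) (undup s)]);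
  last by apply/setP=> x; rewrite !inE; apply: eq_all_r => k; rewrite mem_undup.
have uj : size (undup s) <= j by apply: leq_trans (size_undup s) sj.
apply: leq_trans (capacity_uniq _ _).
- by case: (size _) uj j3 => [|[|[|[|]]]]; case: j {sj} => [|[|[|[|]]]] //=; lia.
- rewrite map_inj_in_uniq ?undup_uniq // => k l.
  by rewrite !mem_undup; exact: inj.
- exact: leq_trans uj j3.
Qed.
End Colours.

Definition deg (V : finType) (e : rel V) (v : V) := #|[set u | e v u]|.

Definition delete_star (V : finType) (e : rel V) (a : V) (S : {set V}) : rel V :=
  fun u v => [&& e u v, ~~ ((u == a) && (v \in S)) & ~~ ((v == a) && (u \in S))].

Lemma leq_card_bigcup_sum (T I : finType) (A : {set I}) (B : I -> {set T}) (n : I -> nat) :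
  (forall i, i \in A -> #|B i| <= n i) -> #|\bigcup_(i in A) B i| <= \sum_(i in A) n i.
Proof.
move=> Bn; elim/big_ind2: _ => [|p P q Q hp hq|//]; first by rewrite cards0.
by rewrite cardsU (leq_trans (leq_subr _ _)) // leq_add.
Qed.

Section Recolouring.
Variables (F : finFieldType) (m : nat).
Hypothesis cardF : #|F| = 4 * m + 1.
Hypothesis m_gt1 : 1 < m.
Local Notation colour := (option F * bool)%type.
Variables (V : finType) (sg : V -> V -> bool).
Hypothesis sgC : forall u v, sg u v = sg v u.

(* The key that the colour of u imposes on v through the edge uv. *)
Definition key (f : V -> colour) (u v : V) : colour := ((f u).1, (f u).2 (+) sg u v).

Definition coloring (e : rel V) (f : V -> colour) :=
  forall u v, e u v -> key_ok (key f u v) (f v).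

Let hF : #|F| %% 4 = 1.
Proof. by rewrite cardF; lia. Qed.

Lemma key_okC (f : V -> colour) u v :
  key_ok (key f u v) (f v) = key_ok (key f v u) (f u).
Proof.
rewrite /key_ok /key /= eq_sym (SPplus_signC hF) sgC; congr (_ && (_ == _)).
by rewrite addbCA addbA.
Qed.

Variable e : rel V.
Hypotheses (eC : symmetric e) (eI : irreflexive e).

(** Around [w] in [S], the keys from vertices other than [a] are compatible because [f w] satisfies
    them, and the last hypothesis makes the new key from [a] agree with them. At most three
    compatible keys leave m - 1 > 0 colours. *)
Lemma recolour_star (a : V) (S : {set V}) (f : V -> colour) (x : colour) :
  coloring (delete_star e a S) f ->
  (forall w, w \in S -> e a w) -> {in S &, forall u w, ~~ e u w} ->
  (forall w, w \in S -> deg e w <= 3) ->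
  (forall u, e a u -> u \notin S -> key_ok (key f u a) x) ->
  (forall w u, w \in S -> e w u -> u != a ->
     x.1 = (f u).1 -> x.2 (+) sg a w = (f u).2 (+) sg u w) ->
  exists f', coloring e f'.
Proof.
move=> colf Sa indS degS xR xS.
pose g u := if u == a then x else f u.
have aS : a \notin S by apply/negP=> /Sa; rewrite eI.
pose keys w := [seq key g u w | u <- enum [set u | e w u]].
have exy w : w \in S -> exists y, all ((@key_ok F)^~ y) (keys w).
  move=> wS; have : 0 < #|[set y : colour | all ((@key_ok F)^~ y) (keys w)]|.
    apply: leq_trans (capacity_compat cardF (j := 3) _ _ _) => //=; first by lia.
    (* The edge survives the deletion: [u] is not [a], and it lies outside [S] by independence. *)
    - have okf u : e w u -> u != a -> key_ok (key g u w) (f w).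
        move=> ewu ua; rewrite /key /g (negbTE ua); apply: colf.
        rewrite /delete_star eC ewu (negbTE ua) /= negb_and.
        by rewrite (contraTN (indS _ _ wS)) ?orbT // ewu.
      have agree u : e w u -> u != a ->
          (key g a w).1 = (key g u w).1 -> key g a w = key g u w.
        move=> ewu ua; rewrite /key /g eqxx (negbTE ua) /= => e1.
        by rewrite e1 (xS w u).
      move=> _ _ /mapP[u + ->] /mapP[v + ->].
      rewrite !mem_enum !inE => ewu ewv.
      have [->|ua] := eqVneq u a; have [->|va] := eqVneq v a => //.
      + exact: agree.
      + by move=> /esym h; apply/esym/agree.
      + by apply: key_ok_inj (okf _ ewu ua) (okf _ ewv va).
    - by rewrite size_map -cardE; exact: degS.
  by case/card_gt0P=> y; rewrite inE; exists y.
pose h v := if v == a then x else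
  if v \in S then odflt x [pick y | all ((@key_ok F)^~ y) (keys v)] else f v.
have hS w : w \in S -> forall u, e w u -> key_ok (key g u w) (h w).
  move=> wS u ewu; rewrite /h wS ifN; last by apply: contraNneq aS => <-.
  case: pickP => [y /allP|/(_ _) no]; last by have [y] := exy w wS; rewrite no.
  by apply; apply: map_f; rewrite mem_enum inE.
have hg u : u \notin S -> h u = g u by rewrite /h /g => /negbTE->.
exists h => u v euv.
have [vS|vS] := boolP (v \in S).
  have uS : u \notin S by apply: contraL euv => uS; exact: indS.
  by have := hS v vS u; rewrite /key (hg _ uS) eC; apply.
have [uS|uS] := boolP (u \in S).
  by rewrite key_okC; have := hS u uS v euv; rewrite /key (hg _ vS).
rewrite /key (hg _ uS) (hg _ vS) /g.
have [ua|ua] := eqVneq u a.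
  have va : v != a by apply: contraTneq euv => ->; rewrite ua eI.
  have := xR v; rewrite -ua => /(_ euv vS).
  by have := key_okC g u v; rewrite /key /g ua eqxx (negbTE va) => ->.
have [va|va] := eqVneq v a; first by have := xR u; rewrite -va eC => /(_ euv uS).
by apply: colf; rewrite /delete_star euv (negbTE ua) (negbTE va).
Qed.

Lemma recolour_count (a : V) (S : {set V}) (f : V -> colour) :
  coloring (delete_star e a S) f ->
  (forall w, w \in S -> e a w) -> {in S &, forall u w, ~~ e u w} ->
  (forall w, w \in S -> deg e w <= 3) ->
  #|[set u | e a u] :\: S| <= 3 ->
  \sum_(w in S) (deg e w).-1 < capacity m #|[set u | e a u] :\: S| ->
  exists f', coloring e f'.
Proof.
move=> colf Sa indS degS R3 ltS.
set R := _ :\: S in R3 ltS.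
pose A := [set x : colour | all ((@key_ok F)^~ x) [seq key f u a | u <- enum R]].
(* The forbidden colours for [a]: the vertex of [f u] with the one bit that makes the keys of [a]
   and [u] on [w] conflict. *)
pose B := \bigcup_(w in S) [set ((f u).1, ~~ ((f u).2 (+) sg u w (+) sg a w))
                           | u in [set u | e w u] :\ a].
have Age : capacity m #|R| <= #|A|.
  apply: capacity_compat => //; last by rewrite size_map -cardE.
  move=> _ _ /mapP[u + ->] /mapP[v + ->]; rewrite !mem_enum !inE.
  move=> /andP[uS au] /andP[vS av].
  have aS : a \notin S by apply/negP=> /Sa; rewrite eI.
  by apply: key_ok_inj; apply: colf;
    rewrite /delete_star (eC _ a) ?au ?av (negbTE aS) ?(negbTE uS) ?(negbTE vS) !andbF.
have Ble : #|B| <= \sum_(w in S) (deg e w).-1.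
  apply: leq_card_bigcup_sum => w wS; apply: leq_trans (leq_imset_card _ _) _.
  have := cardsD1 a [set u | e w u]; rewrite inE eC Sa // /deg.
  by move=> ->.
have /subsetPn[x xA xB] : ~~ (A \subset B).
  by apply: contraTN ltS => /subset_leq_card AB; lia.
apply: (recolour_star (x := x)) colf Sa indS degS _ _.
  move=> u au uS; move: xA; rewrite inE => /allP; apply; apply: map_f.
  by rewrite mem_enum !inE uS.
move=> w u wS ewu ua e1; apply/eqP; apply: contraNT xB => ne.
apply/bigcupP; exists w => //; apply/imsetP; exists u; first by rewrite !inE ua.
rewrite -e1 [LHS]surjective_pairing; congr pair; move: ne.
by case: x.2; case: (f u).2; case: (sg a w); case: (sg u w).
Qed.

(** Here [u] may have any degree, so it keeps its colour [f u]; the leaf [v] has no other neighbour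
    whose key could conflict. *)
Lemma recolour_leaf (v u : V) (f : V -> colour) :
  coloring (delete_star e u [set v]) f -> e u v -> deg e v <= 1 ->
  exists f', coloring e f'.
Proof.
move=> colf uv dv.
apply: (recolour_star (x := f u) colf).
- by move=> w /set1P->.
- by move=> w z /set1P-> /set1P->; rewrite eI.
- by move=> w /set1P->; apply: leq_trans dv _.
- move=> w uw; rewrite inE => wv; apply: colf.
  rewrite /delete_star eC uw !inE (negbTE wv) andbF /= negb_and.
  rewrite andbT; by apply/orP; left; apply: contraTneq uw => ->; rewrite eI.
- move=> w z /set1P-> vz zu; exfalso; move: dv; rewrite leqNgt => /negP; apply.
  rewrite /deg (cardsD1 u) (cardsD1 z) !inE zu vz eC uv; lia.
Qed.
End Recolouring.

(** * Discharging *)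

Section Discharging.
Variables (V : finType) (m : nat).
Hypothesis m_gt1 : 1 < m.

Definition edges (e : rel V) := [set p : V * V | e p.1 p.2].

(* The density hypothesis for q = 4m + 1, where 4 - 8 / (q + 3) = (4m + 2) / (m + 1). *)
Definition sparse (e : rel V) := forall S : {set V}, S != set0 ->
  #|[set p in setX S S | e p.1 p.2]| * m.+1 < (4 * m + 2) * #|S|.

Lemma degE (e : rel V) v : deg e v = \sum_(u | e v u) 1.
Proof. by rewrite sum1_card /deg cardsE. Qed.

Lemma card_edges (e : rel V) : #|edges e| = \sum_v deg e v.
Proof.
rewrite -sum1_card; under [RHS]eq_bigr do rewrite degE.
by rewrite pair_big_dep /=; apply: eq_bigl => p; rewrite inE.
Qed.

Definition small_nbrs (e : rel V) (a : V) := [set w | e a w & deg e w <= 3].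

(* Charges are multiplied by 3 * (m + 1): a vertex v starts with 3 * (m + 1) * deg v
   and gives 3 * m to each neighbour of degree 2 and m - 1 to each one of degree 3. *)
Lemma discharging (e : rel V) : symmetric e ->
  (forall u v, e u v -> 1 < deg e v) ->
  (forall u v, e u v -> deg e u <= 3 -> 3 < deg e v) ->
  (forall a, 3 < deg e a -> #|[set u | e a u] :\: small_nbrs e a| <= 3 ->
     capacity m #|[set u | e a u] :\: small_nbrs e a|
       <= \sum_(w in small_nbrs e a) (deg e w).-1) ->
  (12 * m + 6) * #|[set v | 0 < deg e v]| <= 3 * m.+1 * #|edges e|.
Proof.
move=> eC leaf ss big.
pose g w := if deg e w == 2 then 3 * m else m.-1.
pose received w := if deg e w <= 3 then deg e w * g w else 0.
pose sent v := \sum_(w in small_nbrs e v) g w.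
have total : \sum_v sent v = \sum_w received w.
  rewrite /sent (exchange_big_dep predT) //=; apply: eq_bigr => w _.
  rewrite /received; case: ifP => dw.
    rewrite degE big_distrl /=; apply: eq_big => [v|v _]; last by rewrite mul1n.
    by rewrite inE dw andbT eC.
  by rewrite big_pred0 // => v; rewrite inE dw andbF.
have sent0 v : deg e v <= 3 -> sent v = 0.
  move=> dv; rewrite /sent big_pred0 // => w; rewrite inE.
  apply/negbTE; rewrite negb_and -ltnNge.
  by case: (boolP (e v w)) => //= evw; apply: ss evw dv.
have local v : (12 * m + 6) * (0 < deg e v) + sent v <= 3 * m.+1 * deg e v + received v.
  have [dv|dv] := leqP (deg e v) 3.
    rewrite sent0 // /received dv /g.
    have [/eqP|[u uv]] : deg e v = 0 \/ exists u, e v u.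
    - have [/eqP|] := posnP (deg e v); [by left; apply/eqP|].
      by case/card_gt0P=> u; rewrite inE; right; exists u.
    - by move/eqP->; lia.
    - have := leaf u v; rewrite eC uv => /(_ isT).
      (* Degrees 2 and 3 are tight: 6(m + 1) + 6m = 9(m + 1) + 3(m - 1) = 12m + 6. *)
      by case: (deg e v) dv => [|[|[|[|]]]] //= _ _; lia.
  rewrite (_ : received v = 0) ?addn0; last by rewrite /received leqNgt dv.
  rewrite (leq_trans _ dv) // muln1.
  set S := small_nbrs e v; have SN : S \subset [set u | e v u].
    by apply/subsetP => w; rewrite !inE => /andP[].
  have dE : deg e v = #|S| + #|[set u | e v u] :\: S|.
    by rewrite /deg -(cardsID S) (setIidPr SN).
  (* Termwise: 3m + 3 at degree 2 and m + 5 at degree 3. *)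
  have le : sent v + 3 * \sum_(w in S) (deg e w).-1 <= 3 * m.+1 * #|S|.
    rewrite [leqRHS]mulnC -sum_nat_const big_distrr /= -big_split /=.
    apply: leq_sum => w; rewrite inE => /andP[vw dw].
    have := leaf v w vw; rewrite /g.
    by case: (deg e w) dw => [|[|[|[|]]]] //= _ _; lia.
  (* With r <= 3 big neighbours the charge left is at least 3((m + 1)r + c_r), which equals 12m + 6
     for r = 2 and r = 3. With r >= 4 it is at least 12(m + 1). *)
  have := big v dv; rewrite dE; move: (\sum_(w in S) _) le => s le.
  by case: (#|_ :\: _|) => [|[|[|[|r]]]] /=; lia.
rewrite card_edges big_distrr /= -(leq_add2r (\sum_w received w)) -{1}total.
rewrite -big_split /= (_ : _ * #|_| = \sum_v (12 * m + 6) * (0 < deg e v)).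
  by rewrite -big_split /=; apply: leq_sum => v _; exact: local.
rewrite -big_distrr /= -sum1_card big_mkcond; congr (_ * _).
by apply: eq_bigr => v _; rewrite inE; case: (0 < _).
Qed.

Lemma edges_delete_star (e : rel V) (a w : V) (S : {set V}) :
  e a w -> w \in S -> #|edges (delete_star e a S)| < #|edges e|.
Proof.
move=> aw wS; apply/proper_card/properP; split.
  by apply/subsetP=> p; rewrite !inE => /and3P[].
by exists (a, w); rewrite !inE //= /delete_star aw eqxx wS.
Qed.

Lemma sym_delete_star (e : rel V) (a : V) (S : {set V}) :
  symmetric e -> symmetric (delete_star e a S).
Proof. by move=> eC u v; rewrite /delete_star eC; congr (_ && _); rewrite andbC. Qed.

Lemma irr_delete_star (e : rel V) (a : V) (S : {set V}) :
  irreflexive e -> irreflexive (delete_star e a S).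
Proof. by move=> eI u; rewrite /delete_star eI. Qed.

Lemma sparse_delete_star (e : rel V) (a : V) (S : {set V}) :
  sparse e -> sparse (delete_star e a S).
Proof.
move=> sp A /sp; apply: leq_ltn_trans; rewrite leq_mul2r; apply/orP; right.
by apply/subset_leq_card/subsetP=> p; rewrite !inE => /andP[-> /and3P[]].
Qed.
End Discharging.

(** * Excluding a minimal counterexample *)

Lemma sparse_coloring (F : finFieldType) (m : nat) (V : finType) (sg : V -> V -> bool)
    (e : rel V) :
  #|F| = 4 * m + 1 -> 2 < m -> (forall u v, sg u v = sg v u) ->
  symmetric e -> irreflexive e -> sparse m e ->
  exists f : V -> option F * bool, coloring sg e f.
Proof.
move=> cardF m2 sgC; have m1 : 1 < m by apply: ltnW.
(* Only edges are ever deleted, so [V] and [sg] stay fixed in the induction. *)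
have [n] := ubnP #|edges e|; elim: n e => // n IHn e en eC eI sp.
have IH a (S : {set V}) w : e a w -> w \in S ->
    exists f : V -> option F * bool, coloring sg (delete_star e a S) f.
  move=> aw wS; apply: IHn; first exact: leq_trans (edges_delete_star aw wS) _.
  - exact: sym_delete_star.
  - exact: irr_delete_star.
  - exact: sparse_delete_star.
case: (boolP [exists u, exists v, e u v && (deg e v <= 1)]) => [|leaf].
  case/existsP=> u /existsP[v /andP[uv dv]].
  have [f colf] := IH u [set v] v uv (set11 v).
  exact: (recolour_leaf cardF m1 sgC eC eI colf).
case: (boolP [exists u, exists v, [&& e u v, deg e u <= 3 & deg e v <= 3]]) => [|ss].
  case/existsP=> u /existsP[v /and3P[uv du dv]].
  have [f colf] := IH u [set v] v uv (set11 v).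
  have dR : #|[set w | e u w] :\: [set v]| <= 2.
    by move: du; rewrite /deg (cardsD1 v) inE uv add1n ltnS.
  apply: (recolour_count cardF m1 sgC eC eI colf) => //.
  - by move=> w /set1P->.
  - by move=> w z /set1P-> /set1P->; rewrite eI.
  - by move=> w /set1P->.
  - exact: leq_trans dR _.
  (* At most two neighbours remain, so the capacity is at least 2m, while deg v - 1 <= 2 < 2m. *)
  - rewrite big_set1; move: dR; case: #|_ :\: _| => [|[|[|]]] //= _; lia.
case: (boolP [exists a, [&& 3 < deg e a, #|[set u | e a u] :\: small_nbrs e a| <= 3 &
     \sum_(w in small_nbrs e a) (deg e w).-1
       < capacity m #|[set u | e a u] :\: small_nbrs e a|]]) => [|big].
  case/existsP=> a /and3P[da dR dS].
  have [w wS] : exists w, w \in small_nbrs e a.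
    apply/set0Pn; apply: contraTneq da => S0.
    by rewrite -leqNgt; move: dR; rewrite S0 setD0.
  have aw : e a w by move: wS; rewrite inE => /andP[].
  have [f colf] := IH a _ w aw wS.
  apply: (recolour_count cardF m1 sgC eC eI colf) => //.
  - by move=> z; rewrite inE => /andP[].
  - move=> y z; rewrite !inE => /andP[_ dy] /andP[_ dz]; apply: contra ss => yz.
    by apply/existsP; exists y; apply/existsP; exists z; rewrite yz dy dz.
  - by move=> z; rewrite inE => /andP[].
(* [D] carries all the edges; isolated vertices are left out because they have no charge. *)
pose D := [set v | 0 < deg e v].
have [D0|D0] := eqVneq D set0.
  exists (fun=> (None, true)) => u v uv; exfalso.
  have : u \in D by rewrite inE; apply/card_gt0P; exists v; rewrite inE.
  by rewrite D0 inE.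
exfalso.
have := sp D D0.
have -> : [set p in setX D D | e p.1 p.2] = edges e.
  apply/setP=> -[u v]; rewrite !inE /=; case: (boolP (e u v)) => [uv|]; rewrite ?andbF //.
  rewrite andbT; apply/andP; split; apply/card_gt0P.
    by exists v; rewrite inE.
  by exists u; rewrite inE eC.
move=> lt; have: (12 * m + 6) * #|D| <= 3 * m.+1 * #|edges e|; last by lia.
apply: discharging => //.
- move=> u v uv; rewrite ltnNge; apply: contra leaf => dv.
  by apply/existsP; exists u; apply/existsP; exists v; rewrite uv.
- move=> u v uv du; rewrite ltnNge; apply: contra ss => dv.
  by apply/existsP; exists u; apply/existsP; exists v; rewrite uv du.
- move=> a da dR; rewrite leqNgt; apply: contra big => dS.
  by apply/existsP; exists a; rewrite da dR.
Qed.

(** * From colourings to homomorphisms, and from [mad] to sparsity *)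

Lemma switch_seqE (V : finType) (ws : seq V) (sg : V -> V -> bool) u v :
  switch_seq ws sg u v = sg u v (+) odd (count_mem u ws) (+) odd (count_mem v ws).
Proof.
elim: ws => [|w ws IH] /=; first by rewrite !addbF.
rewrite -[LHS]/(switch_at w (switch_seq ws sg) u v) /switch_at IH (eq_sym w u) (eq_sym w v) !oddD.
by case: (u == w); case: (v == w); case: (sg u v); case: (odd _); case: (odd _).
Qed.

(** The vertices to switch are those whose colour has its bit set. *)
Lemma signed_hom_coloring (F : finFieldType) (V : finType) (e : rel V)
    (sg : V -> V -> bool) (f : V -> option F * bool) :
  symmetric e -> (forall u v, sg u v = sg v u) -> coloring sg e f ->
  signed_hom e sg (@SPplus_adj F) (@SPplus_sign F) (fun v => (f v).1).
Proof.
move=> eC sgC colf; exists (fun u v => sg u v (+) (f u).2 (+) (f v).2); split.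
  exists (enum [set v | (f v).2]) => u v _.
  by rewrite switch_seqE !count_uniq_mem ?enum_uniq // !mem_enum !inE !oddb.
move=> u v; rewrite eC => /colf; rewrite /key_ok /key sgC => /andP[ne /eqP /= ->].
by rewrite /SPplus_adj ne /= addbA addbC addbA.
Qed.

Lemma mad_sparse (V : finType) (e : rel V) (m : nat) :
  (mad e < 4%:R - 8%:R / (4 * m + 1 + 3)%:R)%R -> sparse m e.
Proof.
move=> lt S S0.
pose d (A : {set V}) : rat := (#|[set p in setX A A | e p.1 p.2]|%:R / #|A|%:R)%R.
have le : (d S <= mad e)%R by exact: (le_bigmax_cond _ d S0).
have := le_lt_trans le lt; rewrite /d.
have S1 : (0 < #|S|%:R :> rat)%R by rewrite ltr0n card_gt0.
have -> : (4%:R - 8%:R / (4 * m + 1 + 3)%:R = (4 * m + 2)%:R / m.+1%:R :> rat)%R.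
  have -> : ((4 * m + 2)%:R = 4%:R * m.+1%:R - 2%:R :> rat)%R.
    by rewrite -natrM -natrB; [congr _%:R%R|]; lia.
  rewrite (_ : 4 * m + 1 + 3 = 4 * m.+1); last by lia.
  by rewrite natrM; field; rewrite nat1r pnatr_eq0.
rewrite ltr_pdivrMr // mulrAC ltr_pdivlMr ?ltr0n //.
by rewrite -!natrM ltr_nat.
Qed.

Theorem theorem4 (F : finFieldType) (hq9 : (9 < #|F|)%N) (hq4 : #|F| %% 4 = 1)
  (V : finType) (adj : rel V) (sg : V -> V -> bool) :
  signed_graph adj sg ->
  (mad adj < 4%:R - 8%:R / (#|F| + 3)%:R)%R ->
  exists phi : V -> option F, signed_hom adj sg (@SPplus_adj F) (@SPplus_sign F) phi.
Proof.
move=> [eC eI sgC] ltmad; pose m := #|F| %/ 4.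
have cardF : #|F| = 4 * m + 1 by rewrite /m; lia.
have m2 : 2 < m by lia.
move: ltmad; rewrite cardF => /mad_sparse sp.
have [f colf] := sparse_coloring cardF m2 sgC eC eI sp.
by exists (fun v => (f v).1); apply: signed_hom_coloring.
Qed.
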